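(* In linear networks (paths) with $n$ users and i.i.d. edge weights with $\Pr(w_i=v_k)=p_k$, $k=1,\dots,K$, Algorithm 1 (greedy matching) runs in $O(\log n)$ time with high probability. That is, there is a constant $C$ (independent of $n$) such that the probability that Algorithm 1 terminates within $C\log n$ iterations tends to $1$ as $n\to\infty$.
   Context: Linear network: users $u_1,\dots,u_n$, edges $e_i=\{u_i,u_{i+1}\}$ for $i=1,\dots,n-1$, with weight $w_i$ on $e_i$. The weights are i.i.d. and take values in the finite set $\{v_1,\dots,v_K\}$, $0\le v_1<\cdots<v_K$, with $\Pr(w_i=v_k)=p_k$, $\sum_k p_k=1$; $K$, the $v_k$ and the $p_k$ are fixed as $n\to\infty$. Algorithm 1 (greedy matching): initially all users are unmatched. Each iteration has two phases. Proposal phase: every unmatched user having at least one unmatched neighbor sends a proposal to the unmatched neighbor to which it is joined by the edge of largest weight; nodes are assigned unique numbers, and ties are broken in favor of the neighbor with the highest number. Matching phase: every pair of users that proposed to each other is matched and becomes unavailable to others. The algorithm stops when no unmatched user has an unmatched neighbor. All users act in parallel, and one unit of time is one iteration (one proposal phase followed by one matching phase).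
   Formalization: The formal statement also assumes every p_k < 1 (weights are genuinely random); if some p_k = 1, all weights are equal, and with users numbered in path order the algorithm matches one pair per iteration and needs floor(n/2) iterations, so the claim fails. *)

(* Defs.v *)
From HB Require Import structures.
From mathcomp Require Import all_boot all_order all_algebra.
From mathcomp Require Import all_classical all_reals all_analysis.

Set Implicit Arguments.
Unset Strict Implicit.
Unset Printing Implicit Defensive.

Import Order.TTheory GRing.Theory Num.Theory.

Local Open Scope ring_scope.

(* Greedy matching on a finite network with neighbor relation [adj], edge
   weights [wt] (only meaningful on adjacent pairs) and user numbers [num].
   The state of the algorithm is the current matching, a set of pairs of users. *)
Section GreedyMatching.
Variables (R : realDomainType) (V : finType).
Variables (adj : rel V) (wt : V -> V -> R) (num : V -> nat).
Implicit Types (M : {set {set V}}) (x y z : V).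

Definition unmatched M x : bool := x \notin finset.cover M.

Definition available M x y : bool :=
  [&& unmatched M x, unmatched M y & adj x y].

(* [x] proposes to [y]: among the available neighbors of [x], [y] maximizes
   the weight, and then the number. *)
Definition proposes M x y : bool :=
  available M x y &&
  [forall z, available M x z ==>
     (wt x z < wt x y) || (wt x z == wt x y) && (num z <= num y)%N].

Definition greedy_step M : {set {set V}} :=
  M :|: [set e | [exists x, exists y,
           [&& e == [set x; y], proposes M x y & proposes M y x]]].

Definition greedy_matching (t : nat) : {set {set V}} :=
  iter t greedy_step finset.set0.

Definition terminated M : bool := ~~ [exists x, exists y, available M x y].

Definition terminates_within (b : R) : Prop :=
  exists t : nat, t%:R <= b /\ terminated (greedy_matching t).

End GreedyMatching.

(* The path on n users 0, ..., n - 1; its n - 1 edges are indexed by 'I_n.-1,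
   edge i joining the users i and i + 1. *)
Definition path_adj (n : nat) : rel 'I_n :=
  fun x y => (x.+1 == y :> nat) || (y.+1 == x :> nat).

(* The edge between adjacent x and y has index min(x, y); the default value 0
   is never used on adjacent pairs. *)
Definition path_wt (R : realDomainType) (n : nat) (w : 'I_n.-1 -> R)
    (x y : 'I_n) : R :=
  oapp w 0 (insub (minn x y)).

Definition mutually_independent (d : measure_display) (T : measurableType d)
    (R : realType) (P : probability T R) (I : finType)
    (X : I -> {RV P >-> R}) : Prop :=
  forall (S : {set I}) (B : I -> set R), (forall i, measurable (B i)) ->
    P (\bigcap_(i in [set` S]) (X i @^-1` B i))%classic
    = (\prod_(i in S) P (X i @^-1` B i)%classic)%E.

Definition iid_discrete (d : measure_display) (T : measurableType d)
    (R : realType) (P : probability T R) (I : finType) (K : nat)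
    (v p : 'I_K -> R) (X : I -> {RV P >-> R}) : Prop :=
  [/\ forall i x, exists k, X i x = v k,
      forall i k, P (X i @^-1` [set v k])%classic = (p k)%:E
    & mutually_independent X].

(* Main.v *)
Require Import Defs.
From HB Require Import structures.
From mathcomp Require Import all_boot all_order all_algebra.
From mathcomp Require Import all_classical all_reals all_analysis.
From mathcomp Require Import zify ring lra.

Import Order.TTheory GRing.Theory Num.Theory.
Import numFieldNormedType.Exports.

Local Open Scope classical_set_scope.
Local Open Scope ring_scope.

(* An edge strictly heavier than both its neighbors is matched in the first
   iteration.  Fix v_a < v_b of positive probability; three consecutive edges
   carry the weights (v_a, v_b, v_a) with probability q = p_a^2 p_b.  A window
   of 3L edges splits into L independent triples, so by a union bound every
   such window contains a matched user after one iteration, except with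
   probability at most n (1 - q)^L, which is at most 1/n for L of order log n.
   In each iteration every maximal block of at least two consecutive unmatched
   users gets a matched pair, so a block of l unmatched users comes from a
   strictly longer block one iteration earlier; hence an edge available after
   3L iterations would force a window without matched user after the first. *)

(** * One iteration of greedy matching on an arbitrary network *)

Section Greedy.
Context {R : realDomainType} {V : finType}.
Variables (adj : rel V) (wt : V -> V -> R) (num : V -> nat).

Lemma unmatched_step M x :
  unmatched (greedy_step adj wt num M) x -> unmatched M x.
Proof.
apply: contraNN; rewrite /finset.cover => /bigcupP[e eM xe].
by apply/bigcupP; exists e => //; rewrite inE eM.
Qed.

Lemma mutual_matched M x y : proposes adj wt num M x y ->
  proposes adj wt num M y x -> ~~ unmatched (greedy_step adj wt num M) x.
Proof.
move=> xy yx; rewrite negbK; apply/bigcupP.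
exists ([set x; y]%SET); last by rewrite in_set2 eqxx.
rewrite !inE; apply/orP; right; apply/existsP; exists x.
by apply/existsP; exists y; rewrite eqxx xy yx.
Qed.

Lemma proposes_only M x y : available adj M x y ->
  (forall z, available adj M x z -> z = y) -> proposes adj wt num M x y.
Proof.
move=> xy uniq_y; rewrite /proposes xy; apply/forallP => z.
by apply/implyP => /uniq_y ->; rewrite eqxx leqnn orbT.
Qed.

Lemma proposes_two M x y z : available adj M x y -> available adj M x z ->
  (forall u, available adj M x u -> u = y \/ u = z) ->
  proposes adj wt num M x y \/ proposes adj wt num M x z.
Proof.
move=> xy xz two; rewrite /proposes xy xz /=.
have [lt|gt|eq] := ltgtP (wt x y) (wt x z).
- right; apply/forallP => u; apply/implyP => /two[]->; first by rewrite lt.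
  by rewrite eqxx leqnn orbT.
- left; apply/forallP => u; apply/implyP => /two[]->; last by rewrite gt.
  by rewrite eqxx leqnn orbT.
- have [le|/ltnW le] := leqP (num y) (num z).
  + right; apply/forallP => u; apply/implyP => /two[]->.
      by rewrite eq eqxx le orbT.
    by rewrite eqxx leqnn orbT.
  + left; apply/forallP => u; apply/implyP => /two[]->.
      by rewrite eqxx leqnn orbT.
    by rewrite eq eqxx le orbT.
Qed.

End Greedy.

Lemma unmatched_set0 (V : finType) (x : V) : unmatched finset.set0 x.
Proof. by rewrite /unmatched /finset.cover big_set0 finset.in_set0. Qed.

(** * Blocks of unmatched users on a path *)

Section Path.
Context {R : realDomainType} {n : nat}.
Variables (wt : 'I_n -> 'I_n -> R) (num : 'I_n -> nat).
Implicit Types (x y : 'I_n) (M : {set {set 'I_n}}).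

Local Notation adj := (@path_adj n).
Local Notation step := (greedy_step adj wt num).

(* An isolated block of free users has its end users proposing inwards, so the
   first user proposing to the left gets a mutual proposal. *)
Lemma isolated_block_progress M x y : (x < y)%N ->
  (forall z : 'I_n, (x <= z <= y)%N -> unmatched M z) ->
  (forall z : 'I_n, (z.+1 == x)%N || (z == y.+1 :> nat) -> ~~ unmatched M z) ->
  exists2 z : 'I_n, (x <= z <= y)%N & ~~ unmatched (step M) z.
Proof.
move=> xy free ends.
(* [left k] means that user [k], beyond [x], proposes to user [k - 1]. The end user [y] does so, its
   only available neighbor being inside the block. *)
pose left k := (x < k)%N &&
  [exists i : 'I_n, exists j : 'I_n,
     [&& i == k :> nat, j.+1 == k & proposes adj wt num M i j]].
have av (i j : 'I_n) : (x <= i <= y)%N -> (x <= j <= y)%N -> adj i j ->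
    available adj M i j.
  by move=> hi hj ij; rewrite /available !free.
have avP (i j : 'I_n) : (x <= i <= y)%N -> available adj M i j ->
    (x <= j <= y)%N && ((i.+1 == j :> nat) || (j.+1 == i :> nat)).
  move=> hi /and3P[_ uj ij]; rewrite [X in _ && X]ij andbT.
  have := ends j; rewrite uj; move: ij; rewrite /path_adj => ij.
  case: eqP; case: eqP => //= h1 h2; try by move=> /(_ isT).
  by move=> _; move/orP: ij => []/eqP; lia.
have lefty : left y.
  rewrite /left xy /=; apply/existsP; exists y.
  have lt : (y.-1 < n)%N by have := ltn_ord y; lia.
  apply/existsP; exists (Ordinal lt) => /=; rewrite eqxx prednK; last by lia.
  rewrite eqxx /=; apply: proposes_only.
    by apply: av => /=; rewrite /path_adj /=; lia.
  move=> z /avP; rewrite (ltnW xy) leqnn => /(_ isT) h.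
  by apply: val_inj => /=; lia.
have [j ljP minj] := ex_minnP (ex_intro left _ lefty).
case/andP: ljP => xj /existsP[i /existsP[k]] /and3P[/eqP ij /eqP kj pik].
have jy := minj _ lefty.
exists k; first by lia.
apply: mutual_matched pik.
have adj_ki : available adj M k i by apply: av; rewrite /path_adj; lia.
(* The user [k] just before the first left-proposer has to propose right: at [k = x] there is no
   other choice, and elsewhere a left proposal would contradict minimality. *)
have [kx|kx] := eqVneq (k : nat) x.
  apply: proposes_only => // z /avP; rewrite -kx => h.
  by apply: val_inj => /=; move: h; lia.
have lt : (k.-1 < n)%N by have := ltn_ord k; lia.
have adj_kk : available adj M k (Ordinal lt).
  by apply: av; rewrite /path_adj /=; lia.
have [] := proposes_two _ wt num _ _ _ _ adj_ki adj_kk.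
- move=> u /avP h; have {h} : (u = i :> nat) \/ (u = k.-1 :> nat) by lia.
  by case=> h; [left|right]; apply: val_inj.
- by [].
- move=> pk; suff : left k by move/minj; lia.
  apply/andP; split; first by lia.
  apply/existsP; exists k; apply/existsP; exists (Ordinal lt).
  by rewrite eqxx pk /= andbT; lia.
Qed.

(** [l] counts edges, so the block has [l + 1] users; it need not be maximal. *)
Definition free_block M (a l : nat) :=
  (a + l < n)%N /\ forall z : 'I_n, (a <= z <= a + l)%N -> unmatched M z.

(** Users never become unmatched again, so the block was already free before the step. Had it been
    isolated then, the step would have matched one of its users; hence some user adjacent to it was
    free as well, and adding that user lengthens it. *)
Lemma free_block_grow M a l : free_block (step M) a l.+1 ->
  exists a', free_block M a' l.+2.
Proof.
move=> [an free].
have free0 (z : 'I_n) : (a <= z <= a + l.+1)%N -> unmatched M z.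
  by move=> /free/unmatched_step.
have an' : (a < n)%N by lia.
pose x := Ordinal an'; pose y := Ordinal an.
case: (pselect (exists2 z : 'I_n,
    (z.+1 == x)%N || (z == y.+1 :> nat) & unmatched M z)).
  move=> [z /= /orP[/eqP zx|/eqP zy] uz].
  - exists z; split; first by lia.
    move=> u; rewrite leq_eqVlt => /andP[/orP[/eqP/val_inj<- //|h1 h2]].
    by apply: free0; lia.
  - exists a; split; first by have := ltn_ord z; lia.
    move=> u hu; have [/val_inj-> //|h] := eqVneq (u : nat) z.
    by apply: free0; lia.
move=> noz; have [] := @isolated_block_progress M x y.
- by rewrite /=; lia.
- exact: free0.
- by move=> z hz; apply/negP => uz; apply: noz; exists z.
- by move=> z /free ->.
Qed.

(** An available edge is a block with [l = 1]. Going back from iteration [l + 1] to iteration 1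
    takes [l] steps, each adding an edge. *)
Lemma terminated_of_no_free_block l :
  (forall a, ~ free_block (greedy_matching adj wt num 1) a l.+1) ->
  terminated adj (greedy_matching adj wt num l.+1).
Proof.
move=> nofree; apply/negP => /existsP[x /existsP[y /and3P[ux uy xy]]].
have grow t M a : free_block (iter t step M) a 1 ->
    exists a', free_block M a' t.+1.
  elim: t M a => [|t IH] M a; first by exists a.
  by rewrite iterSr => /IH[a' /free_block_grow].
suff [a] : exists a, free_block (greedy_matching adj wt num l.+1) a 1.
  by rewrite /greedy_matching iterSr => /grow[a' /nofree].
wlog xy1 : x y ux uy xy / (x.+1 == y :> nat).
  move=> H; case/orP: (xy) => h; first by apply: (H x y).
  by apply: (H y x) => //; rewrite /path_adj orbC.
exists x; split; first by have := ltn_ord y; lia.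
move=> z hz; have [/val_inj-> //|zx] := eqVneq (z : nat) x.
by have /val_inj-> : z = y :> nat by lia.
Qed.
End Path.

(** * Locally heaviest edges are matched at once *)

Section PathWeights.
Context {R : realDomainType} {n : nat} (w : 'I_n.-1 -> R) (num : 'I_n -> nat).

Lemma path_wtE (x y : 'I_n) (e : 'I_n.-1) : minn x y = e -> path_wt w x y = w e.
Proof. by move=> xy; rewrite /path_wt xy valK. Qed.

(** With everybody still free, each end of [f] has just one other neighbor, across the lighter edge
    [e] or [g], so the two ends choose each other whatever the numbers. *)
Lemma strict_local_max_matched (e f g : 'I_n.-1) (x : 'I_n) :
  f = e.+1 :> nat -> g = f.+1 :> nat -> w e < w f -> w g < w f ->
  x = f :> nat ->
  ~~ unmatched (greedy_matching (@path_adj n) (path_wt w) num 1) x.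
Proof.
move=> fe gf wef wgf xf.
have lty : (f.+1 < n)%N by have := ltn_ord g; lia.
pose y := Ordinal lty.
apply: (@mutual_matched _ _ _ _ _ _ _ y).
- rewrite /proposes /available !unmatched_set0 /=; apply/andP; split.
    by rewrite /path_adj xf /=; lia.
  apply/forallP => z; apply/implyP; rewrite unmatched_set0 /= => /orP[]/eqP h.
    have -> : z = y by apply: val_inj => /=; lia.
    by rewrite eqxx leqnn orbT.
  by rewrite (@path_wtE x z e) ?(@path_wtE x y f) ?wef //=; lia.
- rewrite /proposes /available !unmatched_set0 /=; apply/andP; split.
    by rewrite /path_adj xf /=; lia.
  apply/forallP => z; apply/implyP; rewrite unmatched_set0 /= => /orP[]/eqP /= h.
    by rewrite (@path_wtE y z g) ?(@path_wtE y x f) ?wgf //=; lia.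
  have -> : z = x by apply: val_inj => /=; lia.
  by rewrite eqxx leqnn orbT.
Qed.
End PathWeights.

(** * Cylinder events of independent finite-valued variables *)

Section Cylinders.
Context {d : measure_display} {T : measurableType d} {R : realType}.
Context {P : probability T R} {I : finType} (X : I -> {RV P >-> R}).

Definition cylinder (B : I -> set R) (S : {set I}) : set T :=
  \bigcap_(i in [set` S]) (X i @^-1` B i).

Lemma measurable_cylinder B S : (forall i, measurable (B i)) ->
  measurable (cylinder B S).
Proof.
move=> mB; apply: fin_bigcap_measurable => // i _.
by rewrite -[X in measurable X]setTI; exact: measurable_funPT.
Qed.

Lemma cylinderU B S D :
  cylinder B (S :|: D)%SET = cylinder B S `&` cylinder B D.
Proof.
apply/seteqP; split=> x /=.
  by move=> h; split=> i /= iS; apply: h; rewrite /= inE iS ?orbT.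
by move=> [hS hD] i /=; rewrite inE => /orP[]; [exact: hS|exact: hD].
Qed.

(** Finitely many variables with finitely many values: the event is a finite union of cylinders, one
    for each assignment of values satisfying [Q]. This makes the termination event measurable. *)
Lemma measurable_determined (K : nat) (v : 'I_K -> R) (Q : (I -> R) -> Prop) :
  (forall i x, exists k, X i x = v k) ->
  measurable [set x | Q (fun i => X i x)].
Proof.
move=> val.
have -> : [set x | Q (fun i => X i x)] =
    \bigcup_(f in [set f : {ffun I -> 'I_K} | Q (v \o f)])
      cylinder (fun i => [set v (f i)]) [set: I]%SET.
  apply/seteqP; split=> x /=.
    move=> Qx; have {}val i := cid (val i x).
    exists [ffun i => sval (val i)].
      rewrite /=.
      suff -> : v \o [ffun i => sval (val i)] = (fun i => X i x) by [].
      by apply/funext => i /=; rewrite ffunE; case: (val i).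
    by move=> i _ /=; rewrite ffunE; case: (val i).
  move=> [f /= Qf fx]; suff -> : (fun i => X i x) = v \o f by [].
  by apply/funext => i; apply: fx; rewrite /= inE.
apply: fin_bigcup_measurable => // f _.
by apply: measurable_cylinder => i; exact: measurable_set1.
Qed.

Hypothesis indep : mutually_independent X.
Variables (B : I -> set R) (f : I -> R) (D : nat -> {set I}).
Hypothesis mB : forall i, measurable (B i).
Hypothesis fE : forall i, P (X i @^-1` B i) = (f i)%:E.

Lemma prob_cylinder S : P (cylinder B S) = (\prod_(i in S) f i)%:E.
Proof. by rewrite indep // (eq_bigr _ (fun i _ => fE i)) prodEFin. Qed.

(** Independence is assumed for intersections of preimages, while this event involves complements of
    cylinders. The induction on [L] subtracts from the event avoiding the first [L] cylinders its
    part inside the next one; that part has the same form with [S] enlarged by [D L], which is why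
    [S] is general. *)
Lemma prob_avoid_cylinders L (S : {set I}) :
  (forall j k, (j < k < L)%N -> [disjoint D j & D k]%B) ->
  (forall j, (j < L)%N -> [disjoint S & D j]%B) ->
  P (cylinder B S `&` \bigcap_(j < L) ~` cylinder B (D j)) =
    (\prod_(i in S) f i * \prod_(j < L) (1 - \prod_(i in D j) f i))%:E.
Proof.
elim: L S => [|L IH] S disD disS.
  by rewrite bigcap_mkord !big_ord0 setIT mulr1 prob_cylinder.
pose A k U := cylinder B U `&` \bigcap_(j < k) ~` cylinder B (D j).
have mA k U : measurable (A k U).
  apply: measurableI; first exact: measurable_cylinder.
  by apply: fin_bigcap_measurable => // j _; apply/measurableC/measurable_cylinder.
have disD' j k : (j < k < L)%N -> [disjoint D j & D k]%B.
  by move=> h; apply: disD; lia.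
have disS' j : (j < L)%N -> [disjoint S & D j]%B by move=> h; apply: disS; lia.
have : P (A L S) =
    (P (A L S `\` cylinder B (D L)) + P (A L S `&` cylinder B (D L)))%E.
  by apply: measureDI; [exact: mA|exact: measurable_cylinder].
rewrite /A (IH S) // setIAC -cylinderU IH //; last first.
  move=> j jL; rewrite -setI_eq0 finset.setIUl finset.setU_eq0 !setI_eq0 disS' //=.
  by rewrite disjoint_sym disD // jL /=.
move=> mDI; rewrite big_ord_recr /=.
have -> : \bigcap_(j < L.+1) ~` cylinder B (D j) =
    (\bigcap_(j < L) ~` cylinder B (D j)) `&` ~` cylinder B (D L).
  by rewrite !bigcap_mkord big_ord_recr.
rewrite setIA -setDE.
have prodU : \prod_(i in (S :|: D L)%SET) f i =
    \prod_(i in S) f i * \prod_(i in D L) f i.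
  by rewrite -bigU ?disS //; apply: eq_bigl => i; rewrite !inE.
(* The additivity equation rules out infinite values for the difference, and is then solved for
   it. *)
move: mDI; rewrite prodU.
by case: (P (_ `\` _)) => // r [] h; congr EFin; move: h; lra.
Qed.

End Cylinders.

Lemma prob_avoid_disjoint_cylinders d (T : measurableType d) (R : realType)
    (P : probability T R) (I : finType) (X : I -> {RV P >-> R})
    (B : I -> set R) (f : I -> R) (D : nat -> {set I}) (L : nat) :
  mutually_independent X -> (forall i, measurable (B i)) ->
  (forall i, P (X i @^-1` B i) = (f i)%:E) ->
  (forall j k, (j < k < L)%N -> [disjoint D j & D k]%B) ->
  P (\bigcap_(j < L) ~` cylinder X B (D j)) =
    (\prod_(j < L) (1 - \prod_(i in D j) f i))%:E.
Proof.
move=> indep mB fE disD.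
have := @prob_avoid_cylinders _ _ _ _ _ _ indep _ _ D mB fE L finset.set0 disD.
rewrite big_set0 mul1r => <-; last first.
  by move=> j _; rewrite -setI_eq0 finset.set0I.
congr (P _); apply/seteqP; split=> x /=; last by case.
by move=> h; split=> // i /=; rewrite inE.
Qed.

(** A first atom has mass below 1, so the remaining indices carry positive mass and contain a second
    one. *)
Lemma two_atoms (R : realDomainType) (K : nat) (p : 'I_K -> R) :
  (forall k, 0 <= p k) -> \sum_(k < K) p k = 1 -> (forall k, p k < 1) ->
  exists a b : 'I_K, [/\ (a < b)%N, 0 < p a & 0 < p b].
Proof.
move=> p_ge0 p_sum1 p_lt1.
have atom (A : pred 'I_K) :
    0 < \sum_(k < K | A k) p k -> exists2 k, A k & 0 < p k.
  move=> h; apply: contrapT => no.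
  suff e : \sum_(k < K | A k) p k = 0 by rewrite e ltxx in h.
  apply: big1 => k Ak; apply/eqP; rewrite -[_ == _]negbK; apply/negP => pk.
  by apply: no; exists k => //; rewrite lt_neqAle eq_sym pk p_ge0.
have [|a _ pa] := atom predT; first by rewrite p_sum1.
have [|b ba pb] := atom [pred k | k != a].
  have := p_lt1 a; move: p_sum1; rewrite (bigD1 a) //= => <-.
  by rewrite ltrDl.
have [ab|ab|/val_inj ab] := ltngtP a b; [by exists a, b|by exists b, a|].
by rewrite /= ab eqxx in ba.
Qed.

(** * Peaks in windows of consecutive edges *)

Section Window.
Context {R : realType} {K : nat} (v p : 'I_K -> R) (a b : 'I_K).
Context {d : measure_display} {T : measurableType d} (P : probability T R).
Context {n : nat} (w : 'I_n.-1 -> {RV P >-> R}).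
Hypothesis iid : iid_discrete v p w.

Definition triple (s j : nat) : {set 'I_n.-1} :=
  [set e : 'I_n.-1 | (s + 3 * j <= e < s + 3 * j + 3)%N]%SET.

(** The pattern a, b, a repeated with period 3 from edge [s], so that one family of target sets
    serves all triples of the window. *)
Definition peak_level (s : nat) (e : 'I_n.-1) : 'I_K :=
  if ((e - s) %% 3 == 1)%N then b else a.

Definition peak (s j : nat) : set T :=
  cylinder w (fun e => [set v (peak_level s e)]) (triple s j).

Definition no_peak (L s : nat) : set T := \bigcap_(j < L) ~` peak s j.

Lemma measurable_no_peak L s : measurable (no_peak L s).
Proof.
apply: fin_bigcap_measurable => // j _.
by apply/measurableC/measurable_cylinder => e; exact: measurable_set1.
Qed.

Lemma prob_no_peak L s : (s + 3 * L < n)%N ->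
  P (no_peak L s) = ((1 - p a ^+ 2 * p b) ^+ L)%:E.
Proof.
move=> sn; have [_ wp indep] := iid.
rewrite (@prob_avoid_disjoint_cylinders _ _ _ _ _ _ _
  (fun e => p (peak_level s e))) //.
- have prod_triple (j : 'I_L) :
      \prod_(e in triple s j) p (peak_level s e) = p a ^+ 2 * p b.
    have jL := ltn_ord j.
    have l0 : (s + 3 * j < n.-1)%N by lia.
    have l1 : (s + 3 * j + 1 < n.-1)%N by lia.
    have l2 : (s + 3 * j + 2 < n.-1)%N by lia.
    have -> : triple s j = [set Ordinal l0; Ordinal l1; Ordinal l2]%SET.
      apply/setP => e; rewrite !inE -!val_eqE /=; lia.
    rewrite finset.setUC big_setU1 ?inE -?val_eqE /=; last by lia.
    rewrite big_setU1 ?inE -?val_eqE /=; last by lia.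
    rewrite big_set1 /peak_level /=.
    have -> : ((s + 3 * j - s) %% 3 == 1)%N = false by lia.
    have -> : ((s + 3 * j + 1 - s) %% 3 == 1)%N = true by lia.
    have -> : ((s + 3 * j + 2 - s) %% 3 == 1)%N = false by lia.
    by ring.
  by under eq_bigr do rewrite prod_triple; rewrite prodr_const card_ord.
- move=> j k jk; rewrite -finset.setI_eq0; apply/eqP/setP => e; rewrite !inE.
  by lia.
Qed.

Lemma terminates_of_peaks (num : 'I_n -> nat) (L : nat) (x : T) :
  v a < v b ->
  (forall s, (s + 3 * L.+1 < n)%N -> ~ no_peak L.+1 s x) ->
  terminated (@path_adj n)
    (greedy_matching (@path_adj n) (path_wt (fun e => w e x)) num (3 * L.+1)).
Proof.
(* With this form of the count, the forbidden blocks have exactly [3 * L.+1] edges, the length of a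
   window. *)
move=> vab peaks; rewrite (_ : 3 * L.+1 = (3 * L).+2.+1)%N; last by lia.
apply: terminated_of_no_free_block => s [sn free].
have {peaks} := peaks s; case; first by lia.
move=> j /= jL pk.
have l0 : (s + 3 * j < n.-1)%N by lia.
have l1 : (s + 3 * j + 1 < n.-1)%N by lia.
have l2 : (s + 3 * j + 2 < n.-1)%N by lia.
have lx : (s + 3 * j + 1 < n)%N by lia.
have lvl (e : 'I_n.-1) : (s + 3 * j <= e < s + 3 * j + 3)%N ->
    w e x = v (peak_level s e).
  by move=> h; apply: pk; rewrite /= inE.
have va (e : 'I_n.-1) :
    (e = s + 3 * j :> nat)%N \/ (e = s + 3 * j + 2 :> nat)%N -> w e x = v a.
  move=> h; rewrite lvl; last by lia.
  by rewrite /peak_level; case: eqP => //; lia.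
have vb : w (Ordinal l1) x = v b.
  rewrite lvl /=; last by lia.
  by rewrite /peak_level /=; case: eqP => //; lia.
(* The left end of the middle edge of the peak is matched in the first iteration, although it lies
   in the free block. *)
have := @strict_local_max_matched _ _ (fun e => w e x) num
  (Ordinal l0) (Ordinal l1) (Ordinal l2) (Ordinal lx).
move/(_ _ _ _ _ _)/negP; apply=> /=;
  [lia|lia|by rewrite vb va //; left|by rewrite vb va //; right|by []|].
by apply: free => /=; lia.
Qed.

Lemma prob_terminates_ge (num : 'I_n -> nat) (L : nat) (t : R) :
  v a < v b -> 0 < p a -> 0 < p b -> p a < 1 -> p b < 1 -> (3 * L.+1)%:R <= t ->
  ((1 - n%:R * (1 - p a ^+ 2 * p b) ^+ L.+1)%:E <=
   P [set x | terminates_within (@path_adj n)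
                (path_wt (fun e => w e x)) num t])%E.
Proof.
move=> vab pa pb pa1 pb1 Lt; set E := [set x | _].
have [val _ _] := iid.
have mE : measurable E.
  exact: (@measurable_determined _ _ _ _ _ w K v
    (fun u => terminates_within (@path_adj n) (path_wt u) num t)).
(* Exactly the starting points [s] whose window fits in the path; the union is empty when the path
   is too short. *)
have sub : ~` E `<=` \big[setU/set0]_(s < n - 3 * L.+1) no_peak L.+1 s.
  move=> x; apply: contra_notP => nobad; exists (3 * L.+1)%N; split => //.
  apply: terminates_of_peaks => // s sn bad; apply: nobad.
  by rewrite -bigcup_mkord; exists s => //=; lia.
have : (P (~` E) <= \sum_(s < n - 3 * L.+1) P (no_peak L.+1 s))%E.
  apply: (@content_subadditive _ _ _ P) => //; last exact: measurableC.
  by move=> s _; exact: measurable_no_peak.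
rewrite (eq_bigr (fun=> ((1 - p a ^+ 2 * p b) ^+ L.+1)%:E)); last first.
  by move=> s _; apply: prob_no_peak; have := ltn_ord s; lia.
rewrite sumEFin sumr_const card_ord probability_setC //.
have : P E \is a fin_num by exact: fin_num_measure.
case: (P E) => // r _.
rewrite -EFinB !lee_fin => h.
have : (1 - p a ^+ 2 * p b) ^+ L.+1 *+ (n - 3 * L.+1) <=
    n%:R * (1 - p a ^+ 2 * p b) ^+ L.+1.
  rewrite -[leLHS]mulr_natl; apply: ler_wpM2r; last by rewrite ler_nat; lia.
  by apply: exprn_ge0; nra.
by lra.
Qed.
End Window.

(** * Choice of the constant and passage to the limit *)

Theorem proposition1 (R : realType) (K : nat) (v p : 'I_K -> R)
    (v_ge0 : forall k, 0 <= v k)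
    (v_incr : forall k l : 'I_K, (k < l)%N -> v k < v l)
    (p_ge0 : forall k, 0 <= p k)
    (p_sum1 : \sum_(k < K) p k = 1)
    (p_lt1 : forall k, p k < 1) :
  exists C : R,
    forall (d : nat -> measure_display)
      (T : forall n, measurableType (d n))
      (P : forall n, probability (T n) R)
      (w : forall n, 'I_n.-1 -> {RV (P n) >-> R})
      (num : forall n, 'I_n -> nat),
      (forall n, iid_discrete v p (w n)) ->
      (forall n, injective (num n)) ->
      (fun n => P n [set x | terminates_within (@path_adj n)
                               (path_wt (fun e => w n e x)) (num n)
                               (C * ln (n%:R))]) @ \oo --> 1%E.
Proof.
have [a [b [ab pa pb]]] := two_atoms _ _ _ p_ge0 p_sum1 p_lt1.
have [pa1 pb1] := (p_lt1 a, p_lt1 b).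
set r := 1 - p a ^+ 2 * p b.
have pa2 : p a ^+ 2 < 1 by rewrite expr_lt1 // ltW.
have r0 : 0 < r by rewrite subr_gt0 mulr_ilt1 // ?exprn_ge0 // ltW.
have r1 : r < 1 by rewrite gtrBl mulr_gt0 ?exprn_gt0.
have lnr : ln r < 0 by rewrite ln_lt0 // r0 r1.
(* Chosen so that [r] to the power [c * ln n] is [n ^ -2]: the union bound over at most [n] windows
   then leaves [1 / n]. *)
pose c := - (2 / ln r).
have c0 : 0 < c by rewrite oppr_gt0 pmulr_rlt0 ?invr_lt0 //; lra.
(* The additive 3 absorbs the rounding: [3 * (L n).+1] is at most [3 * c * ln n + 3], hence at most
   [(3 * c + 3) * ln n] once [ln n] is at least 1. *)
exists (3 * c + 3) => d T P w num iid _.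
pose L n := Num.trunc (c * ln n%:R : R).
have ln_ge1 : \forall n \near \oo, 1 <= ln (n%:R : R).
  near=> n; have en : expR 1 <= n%:R :> R by near: n; exact: nbhs_infty_ger.
  rewrite -[leLHS]expRK ler_ln // posrE ?expR_gt0 //.
  exact: lt_le_trans (expR_gt0 1) en.
apply: (@squeeze_cvge _ _ _ _ (fun n => (1 - n%:R^-1)%:E) _ (fun=> 1%E)).
- near=> n.
  have ln1 : 1 <= ln (n%:R : R) by near: n.
  have n0 : (0 < n)%N by near: n; exact: nbhs_infty_gt.
  have n0R : 0 < n%:R :> R by rewrite ltr0n.
  have /andP[Lle Llt] : (L n)%:R <= c * ln (n%:R : R) < (L n).+1%:R.
    by apply: truncn_itv; nra.
  have prob := @prob_terminates_ge _ _ _ _ a b _ _ (P n) _ _ (iid n) (num n) (L n).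
  apply/andP; split.
    apply: le_trans (prob ((3 * c + 3) * ln n%:R) (v_incr _ _ ab) pa pb pa1 pb1 _).
    + rewrite lee_fin lerD2l lerN2 -/r.
      rewrite -ler_pdivlMl //.
      have -> : r ^+ (L n).+1 = expR (ln r * (L n).+1%:R).
        by rewrite mulrC expRM_natl lnK.
      have -> : n%:R^-1 * n%:R^-1 = expR (- 2 * ln n%:R) :> R.
        by rewrite mulNr expRN expRM_natl lnK ?posrE // expr2 invfM.
      (* The exponents compare because [(L n).+1] exceeds [c * ln n] and [ln r] is negative. *)
      rewrite ler_expR; have -> : -2 = c * ln r by rewrite /c; field; lra.
      by nra.
    + by rewrite natrM -natr1; nra.
  apply: probability_le1; have [val _ _] := iid n.
  exact: (@measurable_determined _ _ _ _ _ (w n) K v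
    (fun u => terminates_within (@path_adj n) (path_wt u) (num n) _)).
- have -> : 1%E = (1 - 0)%:E :> \bar R by rewrite subr0.
  apply: cvg_EFin; first exact: nearW.
  apply: cvgB; first exact: cvg_cst.
  apply/gtr0_cvgV0; last exact: cvgr_idn.
  by near=> n; rewrite ltr0n; near: n; exact: nbhs_infty_gt.
- exact: cvg_cst.
Unshelve. all: by end_near.
Qed.
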